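(* Let $(V,\{-,-\})$ be a $\mathbb{Z}^n$-graded Lie algebra and $\pi\in V$ a canonical element. Then the cohomology space $H_{\pi}^{2\deg(\pi)}(V)$ contains the obstructions to extension of formal deformations of $\pi$ of order at least $1$ to higher order deformations. Explicitly: if $q\ge 1$ and $\pi_\nu=\pi+\sum_{i=1}^q\nu^i\pi_i$ is a formal deformation of order $q$ of $\pi$, then $E_{q+1}:=\sum_{i+j=q+1,\; i,j\ge 1}\{\pi_i,\pi_j\}\in V^{2\deg(\pi)}$ is a $\partial_\pi$-cocycle, and there is $\pi_{q+1}\in V^{\deg(\pi)}$ such that $\pi_\nu+\nu^{q+1}\pi_{q+1}$ is a formal deformation of order $q+1$ if and only if the class of $E_{q+1}$ in $H_\pi^{2\deg(\pi)}(V)$ vanishes.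
   Context: All vector spaces are over a field $\mathbb{K}$ of characteristic $0$. For $\alpha,\beta\in\mathbb{Z}^n$ ($n\ge 1$), $\langle\alpha,\beta\rangle=\sum_i\alpha_i\beta_i$. A $\mathbb{Z}^n$-graded Lie algebra is a $\mathbb{Z}^n$-graded vector space $V=\bigoplus_{\alpha\in\mathbb{Z}^n} V^\alpha$ with a bilinear bracket of weight $0$ such that $\{a,b\}=-(-1)^{\langle a,b\rangle}\{b,a\}$ and $\{a,\{b,c\}\}=\{\{a,b\},c\}+(-1)^{\langle a,b\rangle}\{b,\{a,c\}\}$ for homogeneous $a,b,c$ (in exponents, a homogeneous element stands for its degree). A homogeneous element $w$ is odd if $\langle w,w\rangle$ is odd. A canonical element is an odd element $\pi\in V$ with $\{\pi,\pi\}=0$; then $\partial_\pi:=\{\pi,-\}$ squares to zero, and $H^\alpha_\pi(V)=\ker(\partial_\pi|_{V^\alpha})/\partial_\pi(V^{\alpha-\deg\pi})$. A formal deformation of order $q$ of $\pi$ is a series $\pi_\nu=\sum_{i=0}^{q}\nu^i\pi_i$ with $\pi_i\in V^{\deg(\pi)}$, $\pi_0=\pi$, such that $\sum_{i+j=p}\{\pi_i,\pi_j\}=0$ for all $1\le p\le q$. *)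

(* Defs.v *)
From HB Require Import structures.
From mathcomp Require Import all_boot all_order all_algebra.
From mathcomp Require Import generic_quotient ring_quotient boolp.

Set Implicit Arguments.
Unset Strict Implicit.
Unset Printing Implicit Defensive.

Import Order.TTheory GRing.Theory Num.Theory.

Local Open Scope ring_scope.
Local Open Scope quotient_scope.

Definition idot n (a b : 'rV[int]_n) : int := \sum_i a 0 i * b 0 i.

(* The grading is internal: [homog a] is the subspace V^a of the total space,
   and the axioms [homog_span] and [homog_indep] say that V is the direct sum
   of these subspaces. In particular 0 is homogeneous of every degree. *)
Record gradedLie (n : nat) (K : fieldType) := GradedLie {
  carrier :> lmodType K;
  homog : 'rV[int]_n -> submodClosed carrier;
  homog_span : forall v : carrier,
    exists (r : seq 'rV[int]_n) (f : 'rV[int]_n -> carrier),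
      (forall a, f a \in homog a) /\ v = \sum_(a <- r) f a;
  homog_indep : forall (r : seq 'rV[int]_n) (f : 'rV[int]_n -> carrier),
    uniq r -> (forall a, f a \in homog a) -> \sum_(a <- r) f a = 0 ->
    forall a, a \in r -> f a = 0;
  bracket : {bilinear carrier -> carrier -> carrier};
  bracket_homog : forall a b u v, u \in homog a -> v \in homog b ->
    bracket u v \in homog (a + b);
  bracket_anti : forall a b u v, u \in homog a -> v \in homog b ->
    bracket u v = - ((-1) ^ idot a b *: bracket v u);
  bracket_jacobi : forall a b c u v w,
    u \in homog a -> v \in homog b -> w \in homog c ->
    bracket u (bracket v w)
    = bracket (bracket u v) w + (-1) ^ idot a b *: bracket v (bracket u w)
}.

Section LmodQuotient.
Variables (K : fieldType) (M : lmodType K) (I : zmodClosed M).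
Hypothesis I_scale : GRing.scaler_closed I.
Local Notation Q := (Quotient.quot I).

Definition quot_scale (k : K) (x : Q) : Q := \pi_Q (k *: repr x).

Lemma pi_scale k (x : M) : quot_scale k (\pi_Q x) = \pi_Q (k *: x).
Proof.
apply/eqP; rewrite /quot_scale -Quotient.idealrBE -scalerBr.
by apply: I_scale; apply/idP; rewrite Quotient.idealrBE reprK.
Qed.

Lemma quot_scaleA a b x :
  quot_scale a (quot_scale b x) = quot_scale (a * b) x.
Proof. by elim/quotW: x => x; rewrite (pi_scale b) !pi_scale scalerA. Qed.

Lemma quot_scale1 : left_id 1 quot_scale.
Proof. by elim/quotW=> x; rewrite pi_scale scale1r. Qed.

Lemma quot_scaleDr : right_distributive quot_scale +%R.
Proof.
move=> k; elim/quotW=> x; elim/quotW=> y.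
by rewrite -raddfD !pi_scale scalerDr raddfD.
Qed.

Lemma quot_scaleDl v : {morph quot_scale^~ v : a b / a + b}.
Proof. by move=> a b; elim/quotW: v => v; rewrite !pi_scale scalerDl raddfD. Qed.
End LmodQuotient.

Section Cohomology.
Variables (n : nat) (K : fieldType) (V : gradedLie n K).
Implicit Types (d a : 'rV[int]_n) (pi : V).

(* The degree [d] is a parameter because [pi] alone does not determine it when
   pi = 0. *)
Definition canonical_elt d pi : Prop :=
  [/\ pi \in homog V d, odd `|idot d d|%N & bracket V pi pi = 0].

Definition cocycles pi a : {pred V} :=
  [pred v | (v \in homog V a) && (bracket V pi v == 0)].

Definition coboundaries d pi a : {pred V} :=
  [pred v | `[< exists2 u, u \in homog V (a - d) & v = bracket V pi u >]].

Lemma coboundaries_cocycles d pi a : [pchar K] =i pred0 ->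
  canonical_elt d pi -> {subset coboundaries d pi a <= cocycles pi a}.
Proof.
move=> K0 [pid odd_d pipi] v /asboolP [u ud ->]; apply/andP; split.
  by have := bracket_homog pid ud; rewrite addrC subrK.
have sgn : (-1 : K) ^ idot d d = -1.
  move: odd_d; case: (idot d d) => m /= odd_m.
    by rewrite -exprnP -signr_odd odd_m.
  by rewrite NegzE -exprnN -signr_odd /= odd_m expr1 invrN1.
have /eqP := bracket_jacobi pid pid ud.
rewrite pipi linear0l add0r sgn scaleN1r -addr_eq0 -mulr2n -scaler_nat.
by rewrite scaler_eq0 ((pcharf0P K).1 K0).
Qed.

Section CohomologySpace.
Variables (d : 'rV[int]_n) (pi : V) (a : 'rV[int]_n).

Lemma cocycles_submod : submod_closed (cocycles pi a).
Proof.
split=> [|k u v /andP[ua /eqP pu] /andP[va /eqP pv]]; apply/andP; split.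
- exact: rpred0.
- by rewrite linear0r.
- by rewrite rpredD ?rpredZ.
- by rewrite linearPr pu pv scaler0 addr0.
Qed.
HB.instance Definition _ :=
  GRing.isSubmodClosed.Build K V (cocycles pi a) cocycles_submod.

Record cocycle := Cocycle { cocycle_val :> V; _ : cocycle_val \in cocycles pi a }.
HB.instance Definition _ := [isSub for cocycle_val].
HB.instance Definition _ := [Choice of cocycle by <:].
HB.instance Definition _ := [SubChoice_isSubLmodule of cocycle by <:].

(* For canonical [pi] in characteristic 0 these are all the elements of
   partial_pi(V^(a-d)), by [coboundaries_cocycles]. *)
Definition exact_cocycles : {pred cocycle} :=
  [pred z | cocycle_val z \in coboundaries d pi a].

Lemma exact_cocycles_submod : submod_closed exact_cocycles.
Proof.
split=> [|k z w /asboolP[u ua uE] /asboolP[v va vE]]; apply/asboolP.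
  by exists 0; rewrite ?rpred0 // linear0r; exact: (raddf0 \val).
exists (k *: u + v); first by rewrite rpredD ?rpredZ.
by rewrite linearPr -uE -vE; exact: (linearP \val).
Qed.
HB.instance Definition _ :=
  GRing.isSubmodClosed.Build K cocycle exact_cocycles exact_cocycles_submod.

Definition cohomology := Quotient.quot exact_cocycles.
HB.instance Definition _ := GRing.Zmodule.on cohomology.

Let exact_scale : GRing.scaler_closed exact_cocycles.
Proof. exact: rpredZ. Qed.
HB.instance Definition _ := GRing.Zmodule_isLmodule.Build K cohomology
  (quot_scaleA exact_scale) (quot_scale1 exact_scale)
  (quot_scaleDr exact_scale) (quot_scaleDl exact_scale).

Definition cohomology_class (z : cocycle) : cohomology :=
  \pi_(Quotient.quot exact_cocycles) z.

End CohomologySpace.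

(* The truncated series s_0 + nu s_1 + ... + nu^q s_q is the tuple of its
   coefficients. *)
Definition formal_deformation d pi q (s : q.+1.-tuple V) : Prop :=
  [/\ s`_0 = pi,
      forall i, (i <= q)%N -> s`_i \in homog V d
    & forall p, (1 <= p <= q)%N ->
        \sum_(i < p.+1) bracket V s`_i s`_(p - i) = 0].

Definition obstruction q (s : q.+1.-tuple V) : V :=
  \sum_(1 <= i < q.+1) bracket V s`_i s`_(q.+1 - i).

End Cohomology.

Arguments exact_cocycles {n K V} d pi a _.

(* Main.v *)
Require Import Defs.
From HB Require Import structures.
From mathcomp Require Import all_boot all_order all_algebra.
From mathcomp Require Import generic_quotient ring_quotient boolp.

(** Put [P_p] for the coefficient of [nu^p] in [{t, t}], where [t] is a formal
    series with coefficients in [V^d]. Since [d] is odd, the bracket is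
    symmetric on [V^d], and Jacobi says that the cyclic sum of [{u, {v, w}}]
    vanishes there. Hence [3 {t, {t, t}} = 0] ([bracket_series_bianchi]):
    in characteristic 0, [sum_i {t_i, P_(N - i)} = 0] for every [N].

    A deformation of order [q], extended by the coefficient 0 in degree [q + 1],
    has [P_p = 0] for all [p <= q] (for [p = 0] because [{pi, pi} = 0]), while
    [P_(q + 1)] is the obstruction [E].
    For [N = q + 1] only the term [i = 0] of the identity survives, and it is
    [{pi, E}]; so [E] is a cocycle.

    If the new coefficient is [x] instead of 0, then [P_(q + 1)] gains
    [{pi, x} + {x, pi} = 2 {pi, x}] ([square_coef_rcons]). So [x] extends the
    deformation iff [E = {pi, - 2 x}], and since 2 is invertible such an [x]
    exists iff [E] is a coboundary. *)

Set Implicit Arguments.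
Unset Strict Implicit.
Unset Printing Implicit Defensive.

Import GRing.Theory.

Local Open Scope ring_scope.
Local Open Scope quotient_scope.

Section SumReindexing.
Variables (M : zmodType).

Lemma sum_antidiagonal (N i : nat) (g : nat -> nat -> M) : (i <= N)%N ->
  \sum_(j < N.+1) \sum_(k < N.+1 | (i + j + k == N)%N) g j k
  = \sum_(j < (N - i).+1) g j (N - i - j)%N.
Proof.
move=> iN; have leN : ((N - i).+1 <= N.+1)%N by rewrite ltnS leq_subr.
rewrite (big_ord_widen _ (fun j => g j (N - i - j)%N) leN) [RHS]big_mkcond /=.
apply: eq_bigr => j _; case: ifP => [jN | /negbT]; last first.
  rewrite -leqNgt ltn_subLR // => Nij.
  by rewrite big_pred0 // => k; rewrite gtn_eqF // (leq_trans Nij) // leq_addr.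
have kN : (N - i - j < N.+1)%N by rewrite ltnS -subnDA leq_subr.
rewrite (big_pred1 (Ordinal kN)) // => k; rewrite /= -val_eqE /=.
have ijN : (i + j <= N)%N by move: jN; rewrite ltnS leq_subRL.
by rewrite -[RHS](eqn_add2l (i + j)) -subnDA subnKC.
Qed.

(** Summing over all triples of ordinals, with a condition [i + j + k = N] that
    is symmetric, makes rotation of the indices a mere exchange of sums. *)
Lemma sum_triple_rotate (N : nat) (F : nat -> nat -> nat -> M) :
  \sum_(i < N.+1) \sum_(j < N.+1) \sum_(k < N.+1 | (i + j + k == N)%N) F j k i =
  \sum_(i < N.+1) \sum_(j < N.+1) \sum_(k < N.+1 | (i + j + k == N)%N) F i j k.
Proof.
rewrite exchange_big /=; apply: eq_bigr => j _.
under eq_bigr => i _ do rewrite big_mkcond.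
rewrite exchange_big /=; apply: eq_bigr => k _.
by rewrite [RHS]big_mkcond; apply: eq_bigr => i _; rewrite -addnA addnC.
Qed.

End SumReindexing.

Section OddDegree.
Variables (n : nat) (K : fieldType) (V : gradedLie n K) (d : 'rV[int]_n).
Hypothesis d_odd : odd `|idot d d|%N.

Lemma odd_degree_sign : (-1 : K) ^ idot d d = -1.
Proof.
move: d_odd; case: (idot d d) => m odd_m.
  by rewrite -exprnP -signr_odd odd_m.
by rewrite NegzE -exprnN -signr_odd odd_m expr1 invrN1.
Qed.

Lemma idotDl (a b c : 'rV[int]_n) : idot (a + b) c = idot a c + idot b c.
Proof.
by rewrite /idot -big_split; apply: eq_bigr => i _; rewrite mxE mulrDl.
Qed.

Lemma bracket_odd_sym (u v : V) :
  u \in homog V d -> v \in homog V d -> bracket V u v = bracket V v u.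
Proof.
by move=> ud vd; rewrite (bracket_anti ud vd) odd_degree_sign scaleN1r opprK.
Qed.

(** The inner bracket has even degree [2d], so moving it across an element of
    degree [d] costs the sign [-1] of ordinary antisymmetry; this turns the
    Leibniz form of Jacobi into the cyclic form. *)
Lemma bracket_odd_jacobi (u v w : V) :
  u \in homog V d -> v \in homog V d -> w \in homog V d ->
  bracket V u (bracket V v w) + bracket V v (bracket V w u)
    + bracket V w (bracket V u v) = 0.
Proof.
move=> ud vd wd.
have even_sign : (-1 : K) ^ idot (d + d) d = 1.
  by rewrite idotDl expfzDr ?oppr_eq0 ?oner_eq0 // odd_degree_sign mulrNN mulr1.
rewrite (bracket_jacobi ud vd wd) odd_degree_sign scaleN1r.
rewrite (bracket_anti (bracket_homog ud vd) wd) even_sign scale1r.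
by rewrite (bracket_odd_sym wd ud) addrNK addNr.
Qed.

End OddDegree.

Section BracketSeries.
Variables (n : nat) (K : fieldType) (V : gradedLie n K) (d : 'rV[int]_n).
Implicit Types (t : nat -> V).

(** The coefficient of [nu^p] in [{t, t}]. *)
Definition square_coef t p : V :=
  \sum_(i < p.+1) bracket V (t i) (t (p - i)%N).

Lemma square_coefS t p :
  square_coef t p.+1 = bracket V (t 0%N) (t p.+1) + bracket V (t p.+1) (t 0%N)
    + \sum_(1 <= i < p.+1) bracket V (t i) (t (p.+1 - i)%N).
Proof.
rewrite /square_coef.
rewrite -(big_mkord predT (fun i => bracket V (t i) (t (p.+1 - i)%N))).
rewrite big_nat_recl // big_nat_recr //= subn0 subnn big_add1 /=.
by rewrite -addrA; congr (_ + _); exact: addrC.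
Qed.

(** This is [{t, {t, t}} = 0], coefficient by coefficient: the sum over
    [i + j + k = N] of [{t_i, {t_j, t_k}}] equals each of its two rotations, and
    the three add up to a sum of cyclic Jacobi expressions. *)
Lemma bracket_series_bianchi t N : [pchar K] =i pred0 ->
  odd `|idot d d|%N -> (forall i, t i \in homog V d) ->
  \sum_(i < N.+1) bracket V (t i) (square_coef t (N - i)) = 0.
Proof.
move=> K0 d_odd td.
pose F i j k := bracket V (t i) (bracket V (t j) (t k)).
have -> : \sum_(i < N.+1) bracket V (t i) (square_coef t (N - i)) =
    \sum_(i < N.+1) \sum_(j < N.+1) \sum_(k < N.+1 | (i + j + k == N)%N) F i j k.
  apply: eq_bigr => i _; rewrite (sum_antidiagonal (F i)) ?leq_ord //.
  exact: linear_sumr.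
set S := (X in X = 0).
have S3 : S + S + S = 0.
  rewrite -{2}[S](sum_triple_rotate N F).
  rewrite -[X in _ + X](sum_triple_rotate N F).
  rewrite -[X in _ + X](sum_triple_rotate N (fun i j k => F j k i)).
  rewrite -!big_split big1 // => i _; rewrite -!big_split big1 // => j _.
  rewrite -!big_split big1 // => k _; exact: (bracket_odd_jacobi d_odd).
apply/eqP; have /eqP : 3%:R *: S = 0 by rewrite scaler_nat !mulrS addr0 addrA.
by rewrite scaler_eq0 ((pcharf0P K).1 K0).
Qed.

End BracketSeries.

Section Extension.
Variables (n : nat) (K : fieldType) (V : gradedLie n K).
Variables (d : 'rV[int]_n) (pi : V).

Lemma cohomology_class_eq0 a (z : cocycle pi a) :
  cohomology_class d z = 0 <->
  exists2 u, u \in homog V (a - d) & cocycle_val z = bracket V pi u.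
Proof.
rewrite /cohomology_class.
rewrite -[0](raddf0 (\pi_(Quotient.quot (exact_cocycles d pi a)))).
split=> [/eqP|zE]; last apply/eqP; rewrite -Quotient.idealrBE subr0.
  by move/asboolP.
exact/asboolP.
Qed.

Variables (q : nat) (s : q.+1.-tuple V).
Hypotheses (d_odd : odd `|idot d d|%N) (pi_sq : bracket V pi pi = 0).
Hypothesis hs : formal_deformation d pi s.

(** The default value 0 of [nth] beyond the tuple supplies the coefficient 0 in
    degree [q + 1]: [nth 0 s] is the extension of [s] by 0. *)
Lemma deformation_coef_homog i : s`_i \in homog V d.
Proof.
case: hs => _ sd _; case: (leqP i q) => [/sd //|qi].
by rewrite nth_default ?size_tuple // rpred0.
Qed.

Lemma deformation_square_coef0 p : (p <= q)%N -> square_coef (nth 0 s) p = 0.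
Proof.
case: hs => s0 _ sE; case: p => [_|p pq]; last exact: sE.
by rewrite /square_coef big_ord1 s0.
Qed.

Lemma square_coef_obstruction :
  square_coef (nth 0 s) q.+1 = obstruction s.
Proof.
rewrite square_coefS [s`_q.+1]nth_default ?size_tuple //.
by rewrite linear0r linear0l !add0r.
Qed.

Lemma obstruction_homog : obstruction s \in homog V (d *+ 2).
Proof.
apply: rpred_sum => i _; rewrite mulr2n.
by apply: bracket_homog; exact: deformation_coef_homog.
Qed.

Lemma bracket_obstruction : [pchar K] =i pred0 ->
  bracket V pi (obstruction s) = 0.
Proof.
move=> K0.
have := bracket_series_bianchi q.+1 K0 d_odd deformation_coef_homog.
rewrite big_ord_recl subn0 square_coef_obstruction; case: hs => -> _ _.
rewrite big1 ?addr0 // => i _.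
by rewrite lift0 subSS deformation_square_coef0 ?leq_subr // linear0r.
Qed.

Lemma square_coef_rcons x : x \in homog V d ->
  square_coef (nth 0 (rcons s x)) q.+1
  = bracket V pi (x *+ 2) + obstruction s.
Proof.
move=> xd; case: hs => s0 sd _; rewrite square_coefS; congr (_ + _).
  rewrite !nth_rcons size_tuple ltnn eqxx /= s0 raddfMn mulr2n.
  by rewrite [in LHS](bracket_odd_sym d_odd xd) // -s0 sd.
apply: eq_big_nat => i /andP[i_gt0 iq].
by rewrite !nth_rcons size_tuple iq ltn_subrL i_gt0.
Qed.

Lemma deformation_rcons x : x \in homog V d ->
  formal_deformation d pi [tuple of rcons s x] <->
  bracket V pi (x *+ 2) + obstruction s = 0.
Proof.
move=> xd; rewrite -square_coef_rcons //; split=> [[_ _ sE]|sE].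
  by apply: sE; rewrite leqnn.
case: hs => s0 sd sP; split=> [|i|p /andP[p_gt0]] /=.
- by rewrite nth_rcons size_tuple.
- rewrite leq_eqVlt ltnS nth_rcons size_tuple => /orP[/eqP->|iq].
    by rewrite ltnn eqxx.
  by rewrite ltnS iq sd.
rewrite leq_eqVlt ltnS => /orP[/eqP-> //|pq].
rewrite -[RHS](sP p) ?p_gt0 //; apply: eq_bigr => i _.
have ip : (i <= p)%N by rewrite -ltnS.
rewrite !nth_rcons size_tuple !ltnS (leq_trans ip pq).
by rewrite (leq_trans (leq_subr _ _) pq).
Qed.

End Extension.

Theorem proposition1 (n : nat) (hn : (1 <= n)%N) (K : fieldType)
    (hK : [pchar K] =i pred0) (V : gradedLie n K) (d : 'rV[int]_n) (pi : V)
    (hpi : canonical_elt d pi) (q : nat) (hq : (1 <= q)%N)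
    (s : q.+1.-tuple V) (hs : formal_deformation d pi s) :
  obstruction s \in homog V (d *+ 2) /\
  exists hE : obstruction s \in cocycles pi (d *+ 2),
    (exists2 x : V, x \in homog V d &
       formal_deformation d pi [tuple of rcons s x])
    <-> cohomology_class d (Cocycle hE) = 0.
Proof.
case: hpi => _ d_odd pi_sq; have Ed := obstruction_homog hs.
split=> //.
have hE : obstruction s \in cocycles pi (d *+ 2).
  by apply/andP; split=> //; apply/eqP; exact: (bracket_obstruction d_odd).
have two_neq0 : 2%:R != 0 :> K by rewrite ((pcharf0P K).1 hK).
exists hE; rewrite cohomology_class_eq0 /= mulr2n addrK; split.
  case=> x xd /(deformation_rcons d_odd hs xd)/eqP.
  rewrite addrC addr_eq0 -linearNr => /eqP E.
  by exists (- (x *+ 2)); rewrite // -scaler_nat -scaleNr rpredZ.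
case=> u ud E; have xd : - 2%:R^-1 *: u \in homog V d by rewrite rpredZ.
exists (- 2%:R^-1 *: u) => //; apply/(deformation_rcons d_odd hs xd).
by rewrite E -scaler_nat scalerA mulrN mulfV // scaleN1r linearNr addNr.
Qed.
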